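(* Let $m > 1$ be an integer and $a$ an integer such that $\gcd(a,m)$ is square-free, and let $\gamma \in \{\pi/4, 3\pi/4\}$. Then the congruence class of $a$ modulo $m$ contains infinitely many square-free $\gamma$-congruent numbers.
   Context: For $\theta \in \{\pi/4,3\pi/4\}$, a positive integer $n$ is $\theta$-congruent if there exist positive rationals $a,b,c$ such that the triangle with sides $a$, $b\sqrt2$, $c$ has angle $\theta$ opposite $c$ and area $n$; equivalently $ab = 2n$ and $c^2 = a^2+2b^2-2ab$ (for $\theta = \pi/4$), resp. $c^2 = a^2+2b^2+2ab$ (for $\theta=3\pi/4$). *)

(* Defs.v *)
From HB Require Import structures.
From mathcomp Require Import all_boot all_order all_algebra.
Set Implicit Arguments. Unset Strict Implicit. Unset Printing Implicit Defensive.
Import Order.TTheory GRing.Theory Num.Theory.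
Local Open Scope ring_scope.

Inductive angle := PiOver4 | ThreePiOver4.

(* Law of cosines with cos(pi/4) = 1/sqrt 2, sides a, b*sqrt 2, c:
   c^2 = a^2 + 2 b^2 - 2ab  (theta = pi/4)
   c^2 = a^2 + 2 b^2 + 2ab  (theta = 3pi/4);
   area = (1/2) a (b sqrt 2) sin theta = ab/2. *)
Definition law_of_cosines (th : angle) (a b c : rat) : Prop :=
  match th with
  | PiOver4 => c ^+ 2 = a ^+ 2 + 2 * b ^+ 2 - 2 * a * b
  | ThreePiOver4 => c ^+ 2 = a ^+ 2 + 2 * b ^+ 2 + 2 * a * b
  end.

Definition theta_congruent (th : angle) (n : nat) : Prop :=
  (0 < n)%N /\
  exists a b c : rat, 0 < a /\ 0 < b /\ 0 < c /\
    a * b = 2 * n%:R /\ law_of_cosines th a b c.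

(* Square-free natural number: no square d^2 > 1 divides it (so 0 is not). *)
Definition squarefree (n : nat) : Prop :=
  forall d : nat, (d * d %| n)%N -> d = 1%N.

(* Main.v *)
Require Import Defs.
From mathcomp Require Import all_boot all_order all_algebra.
From mathcomp Require Import zify ring.
Set Implicit Arguments. Unset Strict Implicit. Unset Printing Implicit Defensive.
Import Order.TTheory GRing.Theory Num.Theory.

(** Completing the square, the law of cosines reads c^2 = (a -+ b)^2 + b^2, so
    up to scaling a = u^2 +- 2 u w - w^2 and b = 2 u w: the theta-congruent
    numbers are the positive values of u w Q, with Q = u^2 +- 2 u w - w^2, up to
    rational squares.  Fix a square-free t congruent to a modulo m and put
    w = r^2 t, where r is divisible by m and by the small primes.  Then
    n = u t Q is theta-congruent, and for u = 1 modulo w it is congruent to t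
    modulo m, with u Q prime to w; it remains to make u Q square-free.  For a
    prime p not dividing w, p^2 | u Q holds for at most three classes of u
    modulo p^2, because Q = (u +- w)^2 - 2 w^2.  So at most 3 (Y / p^2 + 1) of Y
    consecutive choices of u are lost at p, and only p = O(Y) matters because Q
    is quadratic.  Summing over p leaves good choices, because sum p^-2 over
    large p is small and pi(x) = o(x), which follows from the bound 4^x for the
    primorial.  The same sieve, applied to an arithmetic progression, yields t. *)

(** * Chebyshev's bound for the primorial *)

Lemma Euclid_dvd_fact (p n : nat) : prime p -> (p %| n`!) = (p <= n).
Proof.
move=> p_pr; apply/idP/idP => [|le_pn]; last by rewrite dvdn_fact ?prime_gt0.
elim: n => [|n IHn]; first by rewrite Euclid_dvd1.
rewrite factS Euclid_dvdM // => /orP[/dvdn_leq|/IHn/leqW]; exact.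
Qed.

Lemma dvdn_prod_primes (s : seq nat) (n : nat) :
  uniq s -> all prime s -> all (dvdn^~ n) s -> \prod_(p <- s) p %| n.
Proof.
elim: s => [|p s IHs] /=; first by rewrite big_nil dvd1n.
move=> /andP[p_notin s_uniq] /andP[p_pr s_pr] /andP[p_dvd s_dvd].
rewrite big_cons Gauss_dvd; first by rewrite p_dvd IHs.
rewrite big_seq; elim/big_ind: _ => [|x y cop_x cop_y|q q_in].
- exact: coprimen1.
- by rewrite coprimeMr cop_x cop_y.
rewrite prime_coprime // dvdn_prime2 ?(allP s_pr q) //.
by apply: contraNneq p_notin => ->.
Qed.

Lemma bin_odd_le_exp4 (k : nat) : 'C(k.*2.+1, k) <= 4 ^ k.
Proof.
have lt_k : k < k.*2.+2 by lia.
have lt_kS : k.+1 < k.*2.+2 by lia.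
have symC : 'C(k.*2.+1, k.+1) = 'C(k.*2.+1, k).
  by rewrite -bin_sub; [congr 'C(_, _)|]; lia.
have two_terms : 'C(k.*2.+1, k) + 'C(k.*2.+1, k) <= 2 ^ k.*2.+1.
  rewrite -[2]/(1 + 1) expnDn (bigD1 (Ordinal lt_k)) //=.
  rewrite (bigD1 (Ordinal lt_kS)) /=; last by rewrite -val_eqE /=; lia.
  by rewrite symC !exp1n !muln1 addnA leq_addr.
by move: two_terms; rewrite expnS -mul2n expnM -[2 ^ 2]/4; lia.
Qed.

Lemma prod_primes_le_exp4 (k : nat) :
  \prod_(k.+2 <= p < k.*2.+2 | prime p) p <= 4 ^ k.
Proof.
have le_k : k <= k.*2.+1 by lia.
apply: leq_trans (bin_odd_le_exp4 k); apply: dvdn_leq; first by rewrite bin_gt0.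
rewrite -big_filter; apply: dvdn_prod_primes.
- by rewrite filter_uniq // iota_uniq.
- exact: filter_all.
apply/allP => p; rewrite mem_filter mem_index_iota => /and3P[p_pr gt_p le_p].
have: p %| (k.*2.+1)`! by rewrite Euclid_dvd_fact.
by rewrite -(bin_fact le_k) !Euclid_dvdM // !Euclid_dvd_fact //; lia.
Qed.

Definition primorial (n : nat) : nat := \prod_(0 <= p < n.+1 | prime p) p.

Lemma primorial_le_exp4 (n : nat) : primorial n <= 4 ^ n.
Proof.
rewrite /primorial; elim/ltn_ind: n => n IHn.
have [n_le2|n_gt2] := leqP n 2.
  by case: n n_le2 {IHn} => [|[|[|//]]] _; rewrite unlock.
have [n_odd|n_even] := boolP (odd n); last first.
  have n_npr : ~~ prime n by apply: contra n_even => /even_prime; lia.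
  rewrite big_mkcond big_nat_recr //= (negbTE n_npr) muln1 -big_mkcond /=.
  case: n n_gt2 IHn {n_even n_npr} => // n _ IHn.
  by rewrite (leq_trans (IHn n _)) ?leq_exp2l.
have [k nE] : exists k, n = k.*2.+1 by exists n./2; lia.
rewrite nE (big_cat_nat _ (n := k.+2)) //=; last by lia.
rewrite (_ : 4 ^ k.*2.+1 = 4 ^ k.+1 * 4 ^ k); last by rewrite -expnD addSn addnn.
by apply: leq_mul (prod_primes_le_exp4 k); apply: IHn; lia.
Qed.

Definition prime_count (n : nat) : nat := count prime (iota 0 n.+1).

(* The primes in ]4 ^ L, n] alone contribute at least (4 ^ L) ^ (pi(n) - pi(4 ^ L))
   to the primorial of n. *)
Lemma prime_count_le (L n : nat) : L * prime_count n <= n + L * (4 ^ L).+1.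
Proof.
set w := 4 ^ L; rewrite /prime_count.
have small_primes : count prime (iota 0 w.+1) <= w.+1.
  by rewrite -{2}(size_iota 0 w.+1) count_size.
have [le_nw|/ltnW lt_wn] := leqP n w.
  rewrite (leq_trans _ (leq_addl _ _)) // leq_mul2l (leq_trans _ small_primes) ?orbT //.
  by rewrite -(subnKC (_ : n.+1 <= w.+1)) // iotaD count_cat leq_addr.
rewrite -(subnKC (_ : w.+1 <= n.+1)) // iotaD count_cat mulnDr addnC.
rewrite leq_add ?leq_mul2l ?small_primes ?orbT //.
rewrite -(@leq_exp2l 4) // expnM (leq_trans _ (primorial_le_exp4 n)) //.
rewrite /primorial (big_cat_nat _ (n := w.+1)) //= -[X in X <= _]mul1n leq_mul //.
  by apply: prodn_cond_gt0 => p; apply: prime_gt0.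
rewrite -sum1_count expn_sum [X in X <= _]big_seq_cond [X in _ <= X]big_seq_cond.
apply: leq_prod => p /andP[]; rewrite expn1 mem_iota => /andP[/ltnW //].
Qed.

Lemma prime_count_littleo (K : nat) :
  exists n0, forall n, n0 <= n -> K * prime_count n <= n.
Proof.
exists (2 * K * (4 ^ (2 * K)).+1) => n le_n; rewrite -(leq_pmul2l (ltn0Sn 1)) mulnA.
by rewrite (leq_trans (prime_count_le _ _)) // [2 * n]mul2n -addnn leq_add2l.
Qed.

(** * Sieving by squares of primes *)

Lemma count_subU (T : Type) (a b c : pred T) (s : seq T) :
  (forall x, a x -> b x || c x) -> count a s <= count b s + count c s.
Proof.
by move=> sub_a; rewrite -count_predUI (leq_trans (sub_count sub_a s)) ?leq_addr.
Qed.

Lemma count_has_le (S T : Type) (a : S -> pred T) (s : seq S) (t : seq T) :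
  count (fun x => has (a^~ x) s) t <= \sum_(p <- s) count (a p) t.
Proof.
elim: s => [|p s IHs]; first by rewrite big_nil count_pred0.
rewrite big_cons (leq_trans _ (leq_add (leqnn _) IHs)) //.
exact: count_subU.
Qed.

Lemma sum_divn_sqr_le (z Y k : nat) :
  z * \sum_(z.+1 <= p < k) Y %/ p ^ 2 <= Y.
Proof.
case: z => // z; have [le_k|lt_k] := leqP k z.+2; first by rewrite big_geq ?muln0.
rewrite -(ler_nat rat) natrM mulrC -ler_pdivlMr ?ltr0n // natr_sum.
pose inv_pred p : rat := (- p.-1%:R^-1)%R.
have telescope : (\sum_(z.+2 <= p < k) (inv_pred p.+1 - inv_pred p) <= z.+1%:R^-1)%R.
  by rewrite telescope_sumr ?(ltnW lt_k) // /inv_pred opprK gerDr oppr_le0 invr_ge0.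
apply: (@le_trans _ _ (\sum_(z.+2 <= p < k) Y%:R * (inv_pred p.+1 - inv_pred p))%R).
  apply: ler_sum_nat => [[//|[//|p]]] _; rewrite /inv_pred /= opprK.
  have p_gt0 : (0 < p.+1%:R :> rat)%R by rewrite ltr0n.
  have -> : (- p.+2%:R^-1 + p.+1%:R^-1 = (p.+1%:R * p.+2%:R)^-1 :> rat)%R.
    rewrite -[p.+2%:R%R]natr1; move: p.+1%:R%R p_gt0 => x x_gt0.
    by field; rewrite !gt_eqF ?addr_gt0.
  rewrite ler_pdivlMr ?mulr_gt0 ?ltr0n // -!natrM ler_nat.
  by rewrite (leq_trans _ (leq_divM Y (p.+2 ^ 2))) // leq_mul2l leq_mul2r leqnSn !orbT.
by rewrite -mulr_sumr ler_wpM2l.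
Qed.

(* Among the first Y indices, the primes up to D * Y hit at most half through the
   terms Y %/ p ^ 2, since p > 2 * c, and o(Y) more through the constant terms. *)
Lemma square_sieve (P : pred nat) (bad : nat -> pred nat) (c D : nat) :
    (forall p, P p -> prime p && (2 * c < p)) ->
    (forall p Y, P p -> count (bad p) (iota 0 Y) <= c * (Y %/ p ^ 2).+1) ->
    (forall p i, P p -> bad p i -> p <= D * i.+1) ->
  exists i, forall p, P p -> ~~ bad p i.
Proof.
move=> P_prime count_bad bad_bound.
have [n0 pi_small] := prime_count_littleo (4 * c * D.+1).
pose Y := n0.+1; pose k := (D.+1 * Y).+1; pose s := [seq p <- iota 0 k | P p].
have few_primes : 4 * (c * size s) <= Y.
  have size_s : size s <= prime_count (D.+1 * Y).
    by rewrite size_filter sub_count // => p /P_prime/andP[].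
  have le_Y : n0 <= D.+1 * Y by rewrite (leq_trans (leqnSn _)) // leq_pmull.
  rewrite mulnA -(leq_pmul2l (ltn0Sn D)) mulnA (mulnC D.+1).
  exact: leq_trans (leq_mul _ size_s) (pi_small _ le_Y).
have sum_le : 2 * (c * \sum_(p <- s) Y %/ p ^ 2) <= Y.
  rewrite mulnA (leq_trans _ (sum_divn_sqr_le (2 * c) Y k)) // leq_mul //.
  rewrite (big_nat_widenl _ 0) // big_filter /index_iota subn0.
  by apply: (sub_le_big leqnn (fun x y => leq_addr y x)) => p /P_prime/andP[].
have : count (fun i => has (bad^~ i) s) (iota 0 Y) < Y.
  apply: leq_ltn_trans (count_has_le _ _ _) _.
  apply: (@leq_ltn_trans (\sum_(p <- s) c * (Y %/ p ^ 2).+1)).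
    rewrite big_seq [X in _ <= X]big_seq; apply: leq_sum => p.
    by rewrite mem_filter => /andP[/count_bad].
  rewrite -big_distrr /=; under eq_bigr do rewrite -addn1.
  rewrite big_split sum1_size /= mulnDr.
  have Y_gt0 : 0 < Y by [].
  by move: sum_le few_primes Y_gt0; clear; lia.
rewrite -{2}(size_iota 0 Y) ltn_neqAle -all_count => /andP[/allPn[i iY good] _].
exists i => p Pp; apply: contra good => bad_pi; apply/hasP; exists p => //.
rewrite mem_filter Pp mem_iota /k ltnS (leq_trans (bad_bound _ _ Pp bad_pi)) //.
by move: iY; rewrite mem_iota => iY; apply: leq_mul.
Qed.

(** * Square-free numbers in residue classes *)

Lemma squarefreeP (n : nat) :
  squarefree n <-> (forall p, prime p -> ~~ (p ^ 2 %| n)).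
Proof.
split=> [sqf_n p p_pr|no_sqr d d_dvd].
  by apply/negP; rewrite -mulnn => /sqf_n p1; rewrite p1 in p_pr.
apply/eqP/idPn => d_neq1; have pdiv_pr : prime (pdiv d).
  case: d d_dvd d_neq1 => [/= n0|[//|d]] *; last exact: pdiv_prime.
  by have := no_sqr 2 isT; rewrite (dvdn_trans (dvdn0 _) n0).
have /negP[] := no_sqr _ pdiv_pr; apply: dvdn_trans d_dvd.
by rewrite -mulnn dvdn_mul ?pdiv_dvd.
Qed.

Lemma squarefree_gt0 (n : nat) : squarefree n -> 0 < n.
Proof. by case: n => // /squarefreeP/(_ 2 isT); rewrite dvdn0. Qed.

Lemma squarefreeM (x y : nat) :
  coprime x y -> squarefree x -> squarefree y -> squarefree (x * y).
Proof.
move=> cop_xy /squarefreeP sqf_x /squarefreeP sqf_y; apply/squarefreeP => p p_pr.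
have [p_dvd_x|p_ndvd_x] := boolP (p %| x); last first.
  by rewrite Gauss_dvdr ?sqf_y // coprime_pexpl // prime_coprime.
rewrite Gauss_dvdl ?sqf_x // coprime_pexpl //.
exact: coprime_dvdl cop_xy.
Qed.

Lemma squarefree_coprime (n k : nat) : coprime n k ->
  (forall p, prime p -> ~~ (p %| k) -> ~~ (p ^ 2 %| n)) -> squarefree n.
Proof.
move=> cop_nk no_sqr; apply/squarefreeP => p p_pr.
have [p_dvd_k|/no_sqr->//] := boolP (p %| k).
have : coprime p n by rewrite coprime_sym (coprime_dvdr p_dvd_k).
by rewrite prime_coprime //; apply/contra/dvdn_trans/dvdn_exp.
Qed.

Lemma coprimeDMl (x k i : nat) : coprime (x + k * i) k = coprime x k.
Proof. by rewrite -coprime_modl addnC mulnC modnMDl coprime_modl. Qed.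

Lemma coprime_eqmod1 (x k : nat) : x = 1 %[mod k] -> coprime x k.
Proof. by move=> x_mod; rewrite -coprime_modl x_mod coprime_modl coprime1n. Qed.

Lemma exists_coprime_eqmod (a m k : nat) :
  0 < m -> 0 < k -> coprime a m -> exists2 x, x = a %[mod m] & coprime x k.
Proof.
move=> m_gt0 k_gt0 cop_am; pose b := a + m.
have b_gt0 : 0 < b by rewrite addn_gt0 m_gt0 orbT.
have cop_bm : coprime b m by rewrite -coprime_modl modnDr coprime_modl.
(* A prime factor of k divides either b or k', but not both, hence not b + m * k'. *)
pose k' := k`_(\pi(b)^'); exists (b + m * k').
  by rewrite /b -addnA -mulnS addnC mulnC modnMDl.
have cop_bk' : coprime b k' by rewrite coprime_pi' ?part_gt0 // part_pnat.
rewrite -(partnC \pi(b) k_gt0) coprimeMr -/k'; apply/andP; split.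
  rewrite coprime_sym; apply: pnat_coprime (part_pnat _ _) _.
  rewrite -coprime_pi' ?(ltn_addr _ b_gt0) // -coprime_modr modnDl coprime_modr.
  by rewrite coprimeMr cop_bm.
by rewrite mulnC coprimeDMl.
Qed.

Local Open Scope ring_scope.

Lemma Euclid_dvdzM (p : nat) (x y : int) :
  prime p -> (p %| x * y)%Z = (p %| x)%Z || (p %| y)%Z.
Proof. by move=> p_pr; rewrite !dvdzE abszM Euclid_dvdM. Qed.

Lemma coprimez_prime_sqr (p : nat) (x : int) :
  prime p -> coprimez (p%:Z ^+ 2) x = ~~ (p %| x)%Z.
Proof. by move=> p_pr; rewrite coprimez_pexpl // coprimezE prime_coprime. Qed.

Lemma count_dvdz_affine_le (q Y : nat) (c B : int) : (0 < q)%N -> coprimez q B ->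
  (count (fun i : nat => (q %| (c + B * i)%R)%Z) (iota 0 Y) <= (Y %/ q).+1)%N.
Proof.
move=> q_gt0 cop_qB; rewrite -size_filter -(size_map (divn^~ q)).
rewrite -(size_iota 0 (Y %/ q).+1); apply: uniq_leq_size; last first.
  move=> _ /mapP[i + ->]; rewrite mem_filter !mem_iota => /and3P[_ _ lt_iY].
  by rewrite ltnS leq_div2r // ltnW.
rewrite map_inj_in_uniq ?filter_uniq ?iota_uniq // => i j.
rewrite !mem_filter => /andP[q_i _] /andP[q_j _] eq_div.
rewrite (divn_eq i q) (divn_eq j q) eq_div; congr (_ + _)%N; apply/eqP.
rewrite -eqz_nat -!modz_nat eqz_mod_dvd -(Gauss_dvdzr _ cop_qB) mulrBr.
by rewrite (_ : _ - _ = (c + B * i) - (c + B * j)); [exact: rpredB|ring].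
Qed.

Lemma count_dvdz_sqr_affine_le (p Y : nat) (c B : int) : prime p -> ~~ (p %| B)%Z ->
  (count (fun i : nat => (p%:Z ^+ 2 %| (c + B * i)%R)%Z) (iota 0 Y)
     <= (Y %/ p ^ 2).+1)%N.
Proof.
move=> p_pr p_B; apply: (@count_dvdz_affine_le (p ^ 2)).
  by rewrite expn_gt0 prime_gt0.
by rewrite -[(p ^ 2)%N%:Z]/(p%:Z ^+ 2) coprimez_prime_sqr.
Qed.

Lemma exists_squarefree_coprime_eqmod (a m k : nat) :
  (0 < m)%N -> (0 < k)%N -> coprime a m ->
  exists t, [/\ squarefree t, t = a %[mod m] & coprime t k].
Proof.
move=> m_gt0 k_gt0 cop_am; pose K := (2 * k * m)%N.
have K_gt0 : (0 < K)%N by rewrite !muln_gt0 k_gt0.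
have [x x_mod cop_xK] := exists_coprime_eqmod m_gt0 K_gt0 cop_am.
have x_gt0 : (0 < x)%N.
  by case: x {x_mod} cop_xK => //; rewrite /coprime gcd0n => /eqP; rewrite /K; lia.
pose P p := prime p && ~~ (p %| K)%N.
have [p|p Y|p i|i no_sqr] :=
  @square_sieve P (fun p i => p ^ 2 %| x + K * i)%N 1 (x + K).
- move=> /andP[p_pr p_K]; rewrite p_pr ltn_neqAle prime_gt1 // andbT.
  by apply: contraNneq p_K => <-; rewrite /K -mulnA dvdn_mulr.
- move=> /andP[p_pr p_K]; rewrite mul1n.
  exact: (@count_dvdz_sqr_affine_le p Y x K).
- move=> /andP[p_pr _] /dvdn_leq; rewrite addn_gt0 x_gt0 => /(_ isT).
  by have := prime_gt0 p_pr; nia.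
have cop_tK : coprime (x + K * i) K by rewrite coprimeDMl.
exists (x + K * i)%N; split.
- apply: squarefree_coprime cop_tK _ => p p_pr p_K.
  by apply: no_sqr; rewrite /P p_pr.
- by rewrite -x_mod /K addnC mulnAC modnMDl.
by apply: coprime_dvdr cop_tK; rewrite /K mulnAC dvdn_mull.
Qed.

Lemma exists_squarefree_eqmod (a m : nat) :
  (0 < m)%N -> squarefree (gcdn a m) -> exists2 t, squarefree t & t = a %[mod m].
Proof.
set g := gcdn a m => m_gt0 sqf_g; have g_gt0 := squarefree_gt0 sqf_g.
have [a' aE] : exists a', a = (g * a')%N.
  by have /dvdnP[a' ->] := dvdn_gcdl a m; exists a'; rewrite mulnC.
have [m' mE] : exists m', m = (g * m')%N.
  by have /dvdnP[m' ->] := dvdn_gcdr a m; exists m'; rewrite mulnC.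
have m'_gt0 : (0 < m')%N by move: m_gt0; rewrite mE muln_gt0 => /andP[].
have cop_a'm' : coprime a' m'.
  by rewrite /coprime -(eqn_pmul2l g_gt0) muln1 muln_gcdr -aE -mE.
have [t [sqf_t t_mod cop_tg]] := exists_squarefree_coprime_eqmod m'_gt0 g_gt0 cop_a'm'.
exists (g * t)%N; first by apply: squarefreeM; rewrite // coprime_sym.
by rewrite aE mE -!muln_modr t_mod.
Qed.

(** * Square-free values of the quadratic form *)

Lemma dvdz_sqr_subr_sqr (p : nat) (x y : int) : prime p -> ~~ (p %| 2 * x)%Z ->
  (p%:Z ^+ 2 %| x ^+ 2 - y ^+ 2)%Z ->
  (p%:Z ^+ 2 %| x - y)%Z || (p%:Z ^+ 2 %| x + y)%Z.
Proof.
move=> p_pr p_ndvd; rewrite subr_sqr.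
have [p_dvdB|p_ndvdB] := boolP (p %| x - y)%Z; last first.
  by rewrite Gauss_dvdzr ?coprimez_prime_sqr // => ->; rewrite orbT.
rewrite Gauss_dvdzl ?coprimez_prime_sqr => // [->//|]; apply: contra p_ndvd => p_dvdD.
by rewrite (_ : 2 * x = (x - y) + (x + y)); [exact: rpredD|ring].
Qed.

Lemma count_dvdz_sqr_sub_le (p Y : nat) (c B d : int) :
  prime p -> ~~ (p %| B)%Z -> ~~ (p %| 2 * d)%Z ->
  (count (fun i : nat => (p%:Z ^+ 2 %| ((c + B * i) ^+ 2 - d)%R)%Z) (iota 0 Y)
     <= 2 * (Y %/ p ^ 2).+1)%N.
Proof.
move=> p_pr p_B; rewrite Euclid_dvdzM // negb_or => /andP[p_2 p_d].
set root := (X in count X).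
have [/hasP[j _ root_j]|] := boolP (has root (iota 0 Y)); last first.
  by rewrite has_count -leqNgt leqn0 => /eqP->.
set y := c + B * j in root_j.
have p_2y : ~~ (p %| 2 * y)%Z.
  rewrite Euclid_dvdzM // negb_or p_2; apply: contra p_d => p_y.
  rewrite -[d](subKr (y ^+ 2)); apply: rpredB; first exact: dvdz_exp.
  exact: dvdz_trans (dvdz_exp _ _) root_j.
have le_sub := count_dvdz_sqr_affine_le Y (c - y) p_pr p_B.
have le_add := count_dvdz_sqr_affine_le Y (c + y) p_pr p_B.
rewrite mul2n -addnn; apply: leq_trans (leq_add le_sub le_add).
apply: count_subU => i root_i.
rewrite [c - y + _]addrAC [c + y + _]addrAC -rpredBC [_ + y]addrC.
apply: (dvdz_sqr_subr_sqr p_pr p_2y).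
rewrite (_ : _ - _ = (y ^+ 2 - d) - ((c + B * i) ^+ 2 - d)); last by ring.
exact: rpredB.
Qed.

Definition angle_sign (th : angle) : int :=
  match th with PiOver4 => 1 | ThreePiOver4 => -1 end.

Definition angle_form (th : angle) (u w : int) : int :=
  u ^+ 2 + 2 * angle_sign th * u * w - w ^+ 2.

Lemma angle_formE (th : angle) (u w : int) :
  angle_form th u w = (u + angle_sign th * w) ^+ 2 - 2 * w ^+ 2.
Proof. by case: th; rewrite /angle_form /=; ring. Qed.

Lemma angle_form_bounds (th : angle) (u w : int) :
  0 <= w -> 3 * w < u -> 0 < angle_form th u w <= 2 * u ^+ 2.
Proof.
move=> w_ge0 lt_wu; rewrite /angle_form !expr2.
by case: th => /=; apply/andP; split; nia.
Qed.

Lemma angle_form_eqmod1 (th : angle) (u w : int) :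
  (u = 1 %[mod w])%Z -> (angle_form th u w = 1 %[mod w])%Z.
Proof.
move=> /eqP; rewrite eqz_mod_dvd => /dvdzP[k /eqP]; rewrite subr_eq => /eqP->.
apply/eqP; rewrite eqz_mod_dvd; apply/dvdzP.
exists (k * (k * w + 2) + 2 * angle_sign th * (k * w + 1) - w).
by rewrite /angle_form; ring.
Qed.

Lemma dvdz_sqr_mul_angle_form (th : angle) (p : nat) (u w : int) :
  prime p -> ~~ (p %| w)%Z ->
  (p%:Z ^+ 2 %| u * angle_form th u w)%Z =
    (p%:Z ^+ 2 %| u)%Z || (p%:Z ^+ 2 %| angle_form th u w)%Z.
Proof.
move=> p_pr p_w; set Q := angle_form _ _ _.
have dvdz_of_sqr x : (p%:Z ^+ 2 %| x)%Z -> (p %| x)%Z.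
  exact: dvdz_trans (dvdz_exp _ (dvdzz p)).
have [p_u|p_u] := boolP (p %| u)%Z; last first.
  by rewrite Gauss_dvdzr ?coprimez_prime_sqr // (contraNF (@dvdz_of_sqr u)).
have p_Q : ~~ (p %| Q)%Z.
  apply: contra p_w => p_Q; have : (p %| w * w)%Z; last by rewrite Euclid_dvdzM ?orbb.
  rewrite (_ : w * w = u * (u + 2 * angle_sign th * w) - Q); last first.
    by rewrite /Q /angle_form; ring.
  by apply: rpredB => //; apply: dvdz_mulr.
by rewrite Gauss_dvdzl ?coprimez_prime_sqr // (contraNF (@dvdz_of_sqr Q)) ?orbF.
Qed.

Lemma count_dvdz_mul_angle_form_le (th : angle) (p Y : nat) (c B w : int) :
  prime p -> ~~ (p %| B)%Z -> ~~ (p %| 2 * w)%Z ->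
  (count (fun i : nat => (p%:Z ^+ 2 %| ((c + B * i) * angle_form th (c + B * i) w)%R)%Z)
     (iota 0 Y) <= 3 * (Y %/ p ^ 2).+1)%N.
Proof.
move=> p_pr p_B; rewrite Euclid_dvdzM // negb_or => /andP[p_2 p_w].
have p_4w2 : ~~ (p %| 2 * (2 * w ^+ 2))%Z.
  by rewrite expr2 !Euclid_dvdzM // !negb_or p_2 p_w.
have le_lin := count_dvdz_sqr_affine_le Y c p_pr p_B.
have le_sqr := count_dvdz_sqr_sub_le Y (c + angle_sign th * w) p_pr p_B p_4w2.
rewrite -[3%N]/(1 + 2)%N mulnDl mul1n; apply: leq_trans (leq_add le_lin le_sqr).
apply: count_subU => i.
by rewrite dvdz_sqr_mul_angle_form // angle_formE [c + _ + _]addrAC.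
Qed.

Lemma dvdz_sqr_mul_angle_form_le (th : angle) (p : nat) (u w : int) :
  prime p -> ~~ (p %| w)%Z -> 0 <= w -> 3 * w < u ->
  (p%:Z ^+ 2 %| u * angle_form th u w)%Z -> p%:Z <= 2 * u.
Proof.
move=> p_pr p_w w_ge0 lt_wu; have u_gt0 : 0 < u by lia.
have /andP[Q_gt0 Q_le] := angle_form_bounds th w_ge0 lt_wu.
have dvd_le x : 0 < x -> (p%:Z ^+ 2 %| x)%Z -> p%:Z ^+ 2 <= x.
  by move=> x_gt0; rewrite dvdzE abszX => /dvdn_leq; rewrite absz_gt0 gt_eqF //; lia.
rewrite dvdz_sqr_mul_angle_form // => /orP[/dvd_le|/dvd_le] /(_ _)/[!expr2] le_p.
  by have := le_p u_gt0; have := prime_gt0 p_pr; nia.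
by have := le_trans (le_p Q_gt0) Q_le; rewrite expr2; have := prime_gt0 p_pr; nia.
Qed.

(* At most 3 classes modulo p ^ 2 are sieved out, so the primes up to 6 = 2 * 3
   have to divide w. *)
Lemma exists_mul_angle_form_no_sqr (th : angle) (c w : nat) :
  (3 * w < c)%N -> (6`! %| w)%N ->
  exists i : nat, forall p, prime p -> ~~ (p %| w)%N ->
    ~~ (p%:Z ^+ 2 %| (c + w * i)%N%:Z * angle_form th (c + w * i)%N w)%Z.
Proof.
move=> lt_wc fact_dvd_w; pose u i : int := (c + w * i)%N.
pose P p := prime p && ~~ (p %| w)%N.
have [p|p Y|p i|i no_sqr] := @square_sieve P
  (fun p i => (p%:Z ^+ 2 %| u i * angle_form th (u i) w)%Z) 3 (2 * (c + w)).
- move=> /andP[p_pr p_w]; rewrite p_pr ltnNge; apply: contra p_w => le_p6.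
  by rewrite (dvdn_trans _ fact_dvd_w) // dvdn_fact ?prime_gt0.
- move=> /andP[p_pr p_w]; apply: (@count_dvdz_mul_angle_form_le th p Y c w w) => //.
  rewrite Euclid_dvdzM // negb_or p_w andbT; apply: contra p_w => p_2.
  by apply: dvdn_trans p_2 (dvdn_trans _ fact_dvd_w).
- move=> /andP[p_pr p_w] /dvdz_sqr_mul_angle_form_le.
  by rewrite /u => /(_ p_pr p_w); nia.
by exists i => p p_pr p_w; apply: no_sqr; rewrite /P p_pr.
Qed.

Lemma exists_squarefree_angle_form (th : angle) (w N : nat) :
  (0 < w)%N -> (6`! %| w)%N ->
  exists u q : nat, [/\ (N < u)%N, angle_form th u w = q,
    u = 1 %[mod w], q = 1 %[mod w] & squarefree (u * q)].
Proof.
move=> w_gt0 fact_dvd_w; pose c := (1 + w * (N + 3))%N.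
have lt_wc : (3 * w < c)%N by rewrite /c; nia.
have [i no_sqr] := exists_mul_angle_form_no_sqr th lt_wc fact_dvd_w.
move: no_sqr; set u := (c + w * i)%N => no_sqr.
have [lt_wu lt_Nu] : 3 * w%:Z < u /\ (N < u)%N by rewrite /u /c; split; nia.
have u_mod : u = 1 %[mod w].
  by rewrite /u /c -addnA -mulnDr addnC mulnC modnMDl.
have /andP[Q_gt0 _] := angle_form_bounds th (isT : 0 <= w%:Z) lt_wu.
pose q := `|angle_form th u w|%N.
have qE : angle_form th u w = q by rewrite gtz0_abs.
have q_mod : q = 1 %[mod w].
  apply/eqP; rewrite -eqz_nat -!modz_nat -qE; apply/eqP/angle_form_eqmod1.
  by rewrite !modz_nat u_mod.
exists u, q; split=> //; apply: (@squarefree_coprime _ w) => [|p p_pr /no_sqr].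
  by rewrite coprimeMl !coprime_eqmod1.
by rewrite qE; apply; exact: p_pr.
Qed.

(** * Theta-congruent numbers *)

Lemma theta_congruent_angle_form (th : angle) (r u v q : nat) :
  (0 < r)%N -> (0 < u)%N -> (0 < v)%N -> (0 < q)%N ->
  angle_form th u (r ^ 2 * v)%N = q -> theta_congruent th (u * v * q).
Proof.
move=> r_gt0 u_gt0 v_gt0 q_gt0 qE; split; first by rewrite !muln_gt0 u_gt0 v_gt0.
pose w : rat := r%:R ^+ 2 * v%:R.
have {}qE : q%:R = u%:R ^+ 2 + 2 * (angle_sign th)%:~R * u%:R * w - w ^+ 2.
  have := congr1 (intr : int -> rat) qE; rewrite /angle_form -[q%:~R]pmulrn => <-.
  by rewrite !(intrD, intrM, mulrNz, rmorphXn) /= -!pmulrn natrM natrX.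
have r0 : r%:R != 0 :> rat by rewrite pnatr_eq0 -lt0n.
exists (q%:R / r%:R), (2 * u%:R * r%:R * v%:R), ((u%:R ^+ 2 + w ^+ 2) / r%:R).
have u0 : 0 < u%:R :> rat by rewrite ltr0n.
split; first by rewrite divr_gt0 ?ltr0n.
split; first by rewrite !mulr_gt0 ?ltr0n.
split; first by rewrite divr_gt0 ?ltr0n // ltr_wpDr ?sqr_ge0 // exprn_gt0.
split; first by rewrite !natrM; field.
by rewrite qE /w; case: th {qE} => /=; field.
Qed.

Lemma exists_squarefree_theta_congruent (th : angle) (t m N : nat) :
  (0 < m)%N -> squarefree t ->
  exists n : nat, [/\ (N < n)%N, n = t %[mod m], squarefree n & theta_congruent th n].
Proof.
move=> m_gt0 sqf_t; have t_gt0 := squarefree_gt0 sqf_t.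
pose r := (6`! * m)%N; pose w := (r ^ 2 * t)%N.
have r_gt0 : (0 < r)%N by rewrite muln_gt0 fact_gt0.
have w_gt0 : (0 < w)%N by rewrite muln_gt0 expn_gt0 r_gt0.
have r_dvd_w : (r %| w)%N by rewrite dvdn_mulr // (dvdn_exp _ (dvdnn r)).
have fact_dvd_w := dvdn_trans (dvdn_mulr m (dvdnn 6`!)) r_dvd_w.
have m_dvd_w := dvdn_trans (dvdn_mull 6`! (dvdnn m)) r_dvd_w.
have [u [q [lt_Nu qE u_mod q_mod sqf_uq]]] :=
  exists_squarefree_angle_form th N w_gt0 fact_dvd_w.
have /andP[u_gt0 q_gt0] : (0 < u)%N && (0 < q)%N by rewrite -muln_gt0 squarefree_gt0.
have uq_mod : u * q = 1 %[mod w] by rewrite -modnMm u_mod q_mod modnMm.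
exists (u * t * q)%N; split.
- by rewrite -mulnA (leq_trans lt_Nu) // leq_pmulr // muln_gt0 t_gt0.
- have uq_mod_m : u * q = 1 %[mod m] by rewrite -(modn_dvdm _ m_dvd_w) uq_mod modn_dvdm.
  by rewrite mulnAC -modnMml uq_mod_m modnMml mul1n.
- rewrite mulnAC; apply: squarefreeM => //.
  exact: coprime_dvdr (dvdn_mull _ (dvdnn t)) (coprime_eqmod1 uq_mod).
exact: theta_congruent_angle_form qE.
Qed.

Theorem theorem5p4 (m : nat) (a : int) (gamma : angle) :
  (1 < m)%N ->
  squarefree `|gcdz a m%:Z|%N ->
  forall N : nat, exists n : nat,
    (N < n)%N /\ (n%:Z = a %[mod m%:Z])%Z /\ squarefree n /\ theta_congruent gamma n.
Proof.
move=> m_gt1 sqf_gcd N; have m_gt0 := ltnW m_gt1.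
pose a0 := `|(a %% m)%Z|%N.
have a0E : a0%:Z = (a %% m)%Z by rewrite gez0_abs // modz_ge0 // eqz_nat -lt0n.
have [|t sqf_t t_mod] := @exists_squarefree_eqmod a0 m m_gt0.
  by rewrite -gcdz_modl -a0E in sqf_gcd.
have [n [lt_Nn n_mod sqf_n congr_n]] :=
  exists_squarefree_theta_congruent gamma N m_gt0 sqf_t.
exists n; split=> //; split=> //.
by rewrite -(modz_mod a) -a0E !modz_nat n_mod t_mod.
Qed.
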